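(* Let $(\Omega,\mathcal{A},\mu)$ be a $\sigma$-finite measure space and let $X$ be a solid Banach function space on $\Omega$. Put $\mathcal{A}_0:=\{E\in\mathcal{A}:\ \mu(E)>0 \text{ and } \chi_E\in X\}$. Then the following are equivalent: (a) $\inf\{\|\chi_E\|_X:\ E\in\mathcal{A}_0\}=0$. (b) There exists a sequence $\{A_n\}_{n=1}^\infty$ in $\mathcal{A}_0$ such that $A_n\cap A_m=\varnothing$ for all distinct $m,n\in\mathbb{N}$ and $0<\|\chi_{A_n}\|_X\leq \frac{1}{2^n}$ for all $n\in\mathbb{N}$.
   Context: $\mathcal{M}_0(\Omega)$ denotes the set of all $\mathcal{A}$-measurable complex-valued functions on $\Omega$, with functions that are equal $\mu$-almost everywhere identified. A linear subspace $X$ of $\mathcal{M}_0(\Omega)$ equipped with a norm $\|\cdot\|_X$ is called a Banach function space on $\Omega$ if $(X,\|\cdot\|_X)$ is a Banach space. It is called solid if for each $f\in X$ and $g\in\mathcal{M}_0(\Omega)$ with $|g|\leq|f|$ a.e. we have $g\in X$ and $\|g\|_X\leq\|f\|_X$. $\chi_E$ is the characteristic function of $E$. *)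

(* Defs.v *)
From HB Require Import structures.
From mathcomp Require Import all_boot all_order all_algebra.
From mathcomp Require Import all_classical all_reals all_analysis measurable_realfun.
From mathcomp Require Import complex.

Set Implicit Arguments.
Unset Strict Implicit.
Unset Printing Implicit Defensive.

Import Order.TTheory GRing.Theory Num.Theory.
Import numFieldNormedType.Exports.

Local Open Scope classical_set_scope.
Local Open Scope ring_scope.
Local Open Scope complex_scope.
Local Open Scope quotient_scope.

(* The Borel sigma-algebra of the complex plane, presented as that of the plane
   R * R: the least sigma-algebra making Re and Im measurable. *)
Section complex_measurable.
Variable R : realType.

HB.instance Definition _ := isPointed.Build R[i] 0.

Definition complex_borel : set (set R[i]) :=
  g_sigma_preimageU (@complex.Re R) (@complex.Im R).

Let complex_borel0 : complex_borel set0.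
Proof. exact: sigma_algebra0. Qed.

Let complex_borelC A : complex_borel A -> complex_borel (~` A).
Proof. exact: sigma_algebraC. Qed.

Let complex_borel_bigcup (F : (set R[i])^nat) :
  (forall i, complex_borel (F i)) -> complex_borel (\bigcup_i F i).
Proof. exact: sigma_algebra_bigcup. Qed.

HB.instance Definition _ := @isMeasurable.Build default_measure_display R[i]
  complex_borel complex_borel0 complex_borelC complex_borel_bigcup.

Lemma measurable_Re : measurable_fun setT (@complex.Re R).
Proof. by move=> _ B mB; apply: sub_sigma_algebra; left; exists B. Qed.

Lemma measurable_Im : measurable_fun setT (@complex.Im R).
Proof. by move=> _ B mB; apply: sub_sigma_algebra; right; exists B. Qed.

Lemma measurable_complexP d (T : measurableType d) (f : T -> R[i]) :
  measurable_fun setT f <->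
  measurable_fun setT (fun x => complex.Re (f x)) /\
  measurable_fun setT (fun x => complex.Im (f x)).
Proof.
split=> [mf|[mRe mIm]].
  by split; [exact: measurableT_comp measurable_Re mf
            |exact: measurableT_comp measurable_Im mf].
move=> _ B mB; rewrite setTI.
suff: preimage_set_system setT f complex_borel `<=` measurable.
  by apply; exists B => //; rewrite setTI.
rewrite -g_sigma_preimageU_comp; apply: smallest_sub.
  exact: sigma_algebra_measurable.
move=> _ [[C mC <-]|[C mC <-]]; [exact: mRe|exact: mIm].
Qed.

End complex_measurable.

Section complex_measurable_fun.
Context d (T : measurableType d) (R : realType).
Implicit Types f g : T -> R[i].

Lemma measurable_fun_complexD f g : measurable_fun setT f ->
  measurable_fun setT g -> measurable_fun setT (f \+ g).
Proof.
move=> /measurable_complexP[fR fI] /measurable_complexP[gR gI].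
apply/measurable_complexP; split.
  rewrite (_ : (fun _ => _) = fun x => complex.Re (f x) + complex.Re (g x)).
    exact: measurable_funD.
  by apply/funext => x /=; case: (f x) (g x) => [? ?] [? ?].
rewrite (_ : (fun _ => _) = fun x => complex.Im (f x) + complex.Im (g x)).
  exact: measurable_funD.
by apply/funext => x /=; case: (f x) (g x) => [? ?] [? ?].
Qed.

Lemma measurable_fun_complexZ (a : R[i]) f : measurable_fun setT f ->
  measurable_fun setT (fun x => a * f x).
Proof.
move=> /measurable_complexP[fR fI]; apply/measurable_complexP; split.
  rewrite (_ : (fun _ => _) = fun x => complex.Re a * complex.Re (f x) -
      complex.Im a * complex.Im (f x)).
    by apply: measurable_funB; exact: measurable_funM.
  by apply/funext => x /=; case: a (f x) => [? ?] [? ?].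
rewrite (_ : (fun _ => _) = fun x => complex.Re a * complex.Im (f x) +
    complex.Im a * complex.Re (f x)).
  by apply: measurable_funD; exact: measurable_funM.
by apply/funext => x /=; case: a (f x) => [? ?] [? ?].
Qed.

Lemma measurable_fun_complex_indic (E : set T) : measurable E ->
  measurable_fun setT (fun x => (\1_E x)%:C : R[i]).
Proof.
move=> mE; apply/measurable_complexP; split => //=.
exact: measurable_indic.
Qed.

End complex_measurable_fun.

(* {mfun_ mu, T >-> R[i]} is M_0(Omega): measurable functions T -> R[i] modulo
   mu-a.e. equality. Such a class coerces to a representative T -> R[i]. *)
Section M0_lmodType.
Context d (T : measurableType d) (R : realType).
Variable mu : {measure set T -> \bar R}.
Local Notation M0 := {mfun_ mu, T >-> R[i]}.
Implicit Types (f g : T -> R[i]) (u v w : M0) (a b : R[i]).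

(* The class of f; non-measurable functions are sent to the junk value 0. *)
Definition M0_class f : M0 :=
  \pi_M0 (insubd (cst 0 : {mfun T >-> R[i]}) f : {mfun T >-> R[i]}).

Lemma M0_classE f : measurable_fun setT f -> M0_class f = f %[ae mu].
Proof.
move=> mf; rewrite /M0_class.
set g := (insubd _ f : {mfun T >-> R[i]}).
have gf : g = f :> (T -> R[i]) by rewrite -[LHS]/(val g) insubdK ?inE.
have : repr (\pi_M0 g) == g %[mod M0] by rewrite reprK.
by rewrite eqmodE => /asboolP; rewrite -[in X in _ -> X]gf.
Qed.

Lemma M0_eqP u v : u = v <-> u = v %[ae mu].
Proof.
split=> [->|uv]; first exact: ae_eq_refl.
by rewrite -[u]reprK -[v]reprK; apply/eqP; rewrite eqmodE; exact/asboolP.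
Qed.

Lemma measurable_M0 u : measurable_fun setT u.
Proof. exact: measurable_funP. Qed.

Definition M0_zero : M0 := M0_class (cst 0).
Definition M0_opp u : M0 := M0_class (fun x => - u x).
Definition M0_add u v : M0 := M0_class (fun x => u x + v x).
Definition M0_scale a u : M0 := M0_class (fun x => a * u x).

Let zeroE : M0_zero = cst 0 %[ae mu].
Proof. exact/M0_classE/measurable_cst. Qed.

Let oppE u : M0_opp u = (fun x => - u x) %[ae mu].
Proof.
apply: M0_classE; rewrite (_ : (fun _ => _) = fun x => -1 * u x).
  exact/measurable_fun_complexZ/measurable_M0.
by apply/funext => x; rewrite mulN1r.
Qed.

Let addE u v : M0_add u v = (fun x => u x + v x) %[ae mu].
Proof.
by apply/M0_classE/measurable_fun_complexD; exact: measurable_M0.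
Qed.

Let scaleE a u : M0_scale a u = (fun x => a * u x) %[ae mu].
Proof. exact/M0_classE/measurable_fun_complexZ/measurable_M0. Qed.

Let M0_addA : associative M0_add.
Proof.
move=> u v w; apply/M0_eqP; have h1 := addE u (M0_add v w).
have h2 := addE (M0_add u v) w; have h3 := addE u v; have h4 := addE v w.
near=> x => _.
rewrite (near h1 x)// (near h2 x)// (near h3 x)// (near h4 x)//.
exact: addrA.
Unshelve. all: by end_near. Qed.

Let M0_addC : commutative M0_add.
Proof. by move=> u v; congr M0_class; apply/funext => x; rewrite addrC. Qed.

Let M0_add0 : left_id M0_zero M0_add.
Proof.
move=> u; apply/M0_eqP; have h1 := addE M0_zero u; have h2 := zeroE.
near=> x => _.
by rewrite (near h1 x)// (near h2 x)//= add0r.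
Unshelve. all: by end_near. Qed.

Let M0_addN : left_inverse M0_zero M0_opp M0_add.
Proof.
move=> u; apply/M0_eqP; have h1 := addE (M0_opp u) u; have h2 := zeroE.
have h3 := oppE u.
near=> x => _.
by rewrite (near h1 x)// (near h2 x)// (near h3 x)//= addNr.
Unshelve. all: by end_near. Qed.

HB.instance Definition _ :=
  GRing.isZmodule.Build M0 M0_addA M0_addC M0_add0 M0_addN.

Let M0_scaleA a b u : M0_scale a (M0_scale b u) = M0_scale (a * b) u.
Proof.
apply/M0_eqP; have h1 := scaleE a (M0_scale b u); have h2 := scaleE b u.
have h3 := scaleE (a * b) u.
near=> x => _.
by rewrite (near h1 x)// (near h2 x)// (near h3 x)// mulrA.
Unshelve. all: by end_near. Qed.

Let M0_scale1 : left_id 1 M0_scale.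
Proof.
move=> u; apply/M0_eqP; have h := scaleE 1 u.
near=> x => _.
by rewrite (near h x)// mul1r.
Unshelve. all: by end_near. Qed.

Let M0_scaleDr : right_distributive M0_scale +%R.
Proof.
move=> a u v; apply/M0_eqP; have h1 := scaleE a (u + v).
have h2 := addE u v; have h3 := addE (M0_scale a u) (M0_scale a v).
have h4 := scaleE a u; have h5 := scaleE a v.
near=> x => _; rewrite (near h1 x)// (near h2 x)// (near h3 x)//.
by rewrite (near h4 x)// (near h5 x)// mulrDr.
Unshelve. all: by end_near. Qed.

Let M0_scaleDl u : {morph M0_scale^~ u : a b / a + b}.
Proof.
move=> a b; apply/M0_eqP; have h1 := scaleE (a + b) u.
have h2 := scaleE a u; have h3 := scaleE b u.
have h4 := addE (M0_scale a u) (M0_scale b u).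
near=> x => _; rewrite (near h1 x)// (near h4 x)// (near h2 x)//.
by rewrite (near h3 x)// mulrDl.
Unshelve. all: by end_near. Qed.

HB.instance Definition _ := GRing.Zmodule_isLmodule.Build R[i] M0
  M0_scaleA M0_scale1 M0_scaleDr M0_scaleDl.

Lemma M0_0E : (0 : M0) = cst 0 %[ae mu]. Proof. exact: zeroE. Qed.

Lemma M0_NE u : (- u : M0) = (fun x => - u x) %[ae mu]. Proof. exact: oppE. Qed.

Lemma M0_DE u v : (u + v : M0) = (fun x => u x + v x) %[ae mu].
Proof. exact: addE. Qed.

Lemma M0_ZE a u : (a *: u : M0) = (fun x => a * u x) %[ae mu].
Proof. exact: scaleE. Qed.

Definition M0_indic (E : set T) : M0 := M0_class (fun x => (\1_E x)%:C).

Lemma M0_indicE E : measurable E ->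
  M0_indic E = (fun x => (\1_E x)%:C) %[ae mu].
Proof. by move=> mE; exact/M0_classE/measurable_fun_complex_indic. Qed.

End M0_lmodType.

(* A linear subspace X of M_0 with a complete norm. The norm is a function on
   all of M_0, of which only the values on X matter. In bfs_normZ, `|a| is the
   modulus of a, which the library views as an element of R[i]. *)
Record banach_function_space d (T : measurableType d) (R : realType)
    (mu : {measure set T -> \bar R}) := BanachFunctionSpace {
  bfs_set : set {mfun_ mu, T >-> R[i]} ;
  bfs_norm : {mfun_ mu, T >-> R[i]} -> R ;
  bfs_set0 : bfs_set 0 ;
  bfs_setD : forall f g, bfs_set f -> bfs_set g -> bfs_set (f + g) ;
  bfs_setZ : forall (a : R[i]) f, bfs_set f -> bfs_set (a *: f) ;
  bfs_norm_ge0 : forall f, bfs_set f -> 0 <= bfs_norm f ;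
  bfs_norm_eq0 : forall f, bfs_set f -> bfs_norm f = 0 -> f = 0 ;
  bfs_normZ : forall (a : R[i]) f, bfs_set f ->
    (bfs_norm (a *: f))%:C = `|a| * (bfs_norm f)%:C ;
  bfs_normD : forall f g, bfs_set f -> bfs_set g ->
    bfs_norm (f + g) <= bfs_norm f + bfs_norm g ;
  bfs_complete : forall u : nat -> {mfun_ mu, T >-> R[i]},
    (forall n, bfs_set (u n)) ->
    (forall e : R, 0 < e -> exists N : nat, forall m n : nat,
      (N <= m)%N -> (N <= n)%N -> bfs_norm (u m - u n) < e) ->
    exists2 f, bfs_set f & (bfs_norm (u n - f) @[n --> \oo] --> (0 : R)) }.

Section solid_bfs.
Context d (T : measurableType d) (R : realType).
Variables (mu : {measure set T -> \bar R}) (X : banach_function_space mu).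

Definition solid := forall f g : {mfun_ mu, T >-> R[i]},
  bfs_set X f -> {ae mu, forall x, `|g x| <= `|f x|} ->
  bfs_set X g /\ bfs_norm X g <= bfs_norm X f.

Definition bfs_indic_sets : set (set T) :=
  [set E | [/\ measurable E, (0 < mu E)%E & bfs_set X (M0_indic mu E)]].

End solid_bfs.

(* Main.v *)
Require Import Defs.
From mathcomp Require Import all_boot all_order all_algebra.
From mathcomp Require Import all_classical all_reals all_analysis.
From mathcomp Require Import measurable_realfun complex lra.

(** Choose [E_n] in [A_0] with [||chi_(E_n)|| <= 2^-n / 4]. By completeness and
    solidity the decreasing sets [F_n = \bigcup_(k >= n) E_k] satisfy
    [||chi_(F_n)|| <= 2^-(n+1)], hence their intersection is null. Since each
    [F_n] has positive measure, [mu (F_m \ F_(m+1)) > 0] for infinitely many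
    [m], and these pairwise disjoint differences are the required sets. *)

Set Implicit Arguments.
Unset Strict Implicit.
Unset Printing Implicit Defensive.

Import Order.TTheory GRing.Theory Num.Theory.
Import numFieldNormedType.Exports.

Local Open Scope classical_set_scope.
Local Open Scope ring_scope.

Lemma cvg_half_expr (R : realType) : (2^-1) ^+ n @[n --> \oo] --> (0 : R).
Proof.
by apply: cvg_expr; rewrite ger0_norm ?invr_ge0// invf_lt1// ltr1n.
Qed.

(** * The norm and indicators in a Banach function space *)

Section banach_function_space_theory.
Context (R : realType) (d : measure_display) (T : measurableType d).
Context (mu : {measure set T -> \bar R}) (X : banach_function_space mu).
Local Notation M0 := {mfun_ mu, T >-> R[i]}.
Local Notation chi := (M0_indic mu).
Local Notation norm := (bfs_norm X).

Lemma bfs_setN (f : M0) : bfs_set X f -> bfs_set X (- f).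
Proof. by move=> Xf; rewrite -scaleN1r; exact: bfs_setZ. Qed.

Lemma bfs_setB (f g : M0) : bfs_set X f -> bfs_set X g -> bfs_set X (f - g).
Proof. by move=> Xf Xg; apply: bfs_setD => //; exact: bfs_setN. Qed.

Lemma bfs_norm0 : norm 0 = 0.
Proof.
have /= := bfs_normZ 0 (bfs_set0 X).
by rewrite scale0r normr0 mul0r => -[].
Qed.

Lemma bfs_normN (f : M0) : bfs_set X f -> norm (- f) = norm f.
Proof.
move=> Xf; have := bfs_normZ (-1) Xf.
by rewrite scaleN1r normrN1 mul1r => -[].
Qed.

Lemma M0_indic_mem E : measurable E ->
  {ae mu, forall x, chi E x = if x \in E then 1 else 0}.
Proof.
move=> mE; have := M0_indicE mu mE; apply: filterS => x /(_ Logic.I) ->.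
by rewrite indicE; case: (x \in E).
Qed.

(** Needed to form the class of [1 - f] cut down to one set of a sequence, where [f] is a norm
    limit. On real and imaginary parts the cut is multiplication by the real indicator. *)
Lemma measurable_fun_complex_restr (E : set T) (h : T -> R[i]) :
  measurable E -> measurable_fun setT h ->
  measurable_fun setT (fun x => if x \in E then h x else 0).
Proof.
move=> mE /measurable_complexP[hR hI]; apply/measurable_complexP; split.
  rewrite (_ : (fun _ => _) = fun x => \1_E x * complex.Re (h x)).
    by apply: measurable_funM => //; exact: measurable_indic.
  by apply/funext => x; rewrite indicE; case: ifP; rewrite ?mul1r ?mul0r.
rewrite (_ : (fun _ => _) = fun x => \1_E x * complex.Im (h x)).
  by apply: measurable_funM => //; exact: measurable_indic.
by apply/funext => x; rewrite indicE; case: ifP; rewrite ?mul1r ?mul0r.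
Qed.

(** Norm zero would make the indicator the zero class, so 1 = 0 at almost every point of [E], and
    [E] would be negligible. *)
Lemma bfs_norm_indic_gt0 E :
  bfs_indic_sets X E -> 0 < norm (chi E).
Proof.
move=> [mE muE XE]; rewrite lt_neqAle bfs_norm_ge0// andbT eq_sym.
apply/eqP => /(bfs_norm_eq0 XE) E0.
suff : (mu E <= 0)%E by rewrite leNgt muE.
suff : mu.-negligible E by move=> /(measure_negligible mE) ->.
have h1 := M0_indic_mem mE; have h2 := M0_0E mu; rewrite E0 in h1.
suff : {ae mu, forall x, ~ E x} by apply: negligibleS => x Ex; apply.
apply: filterS2 h1 h2 => x chiE zE Ex; move: chiE; rewrite zE// mem_set//=.
by move=> /eqP; rewrite eq_sym oner_eq0.
Qed.

(** * Indicators in a solid space *)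

Hypothesis X_solid : solid X.

(** Off [A] the indicator vanishes, so domination has to be checked on [A] only. The dominating [f]
    is left arbitrary so that sums of indicators and norm limits qualify. *)
Lemma solid_indic (f : M0) A : measurable A -> bfs_set X f ->
  {ae mu, forall x, A x -> 1 <= `|f x|} ->
  bfs_set X (chi A) /\ norm (chi A) <= norm f.
Proof.
move=> mA Xf h; apply: X_solid => //; have h1 := M0_indic_mem mA.
near=> x; have -> : chi A x = if x \in A then 1 else 0 by near: x.
case: ifPn => [/set_mem Ax|_]; last by rewrite normr0.
by rewrite normr1; move: Ax; near: x.
Unshelve. all: by end_near. Qed.

Lemma solid_indicS A B : measurable A -> measurable B -> A `<=` B ->
  bfs_set X (chi B) -> bfs_set X (chi A) /\ norm (chi A) <= norm (chi B).
Proof.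
move=> mA mB AB XB; apply: solid_indic => //; have h1 := M0_indic_mem mB.
near=> x; move=> /AB/mem_set Bx.
have -> : chi B x = if x \in B then 1 else 0 by near: x.
by rewrite Bx normr1.
Unshelve. all: by end_near. Qed.

(** The sum of the two indicators is 1 or 2 on the union, hence dominates its indicator; the
    triangle inequality does the rest. *)
Lemma solid_indicU A B : measurable A -> measurable B ->
  bfs_set X (chi A) -> bfs_set X (chi B) ->
  bfs_set X (chi (A `|` B)) /\
  norm (chi (A `|` B)) <= norm (chi A) + norm (chi B).
Proof.
move=> mA mB XA XB.
have [|||] := @solid_indic (chi A + chi B) (A `|` B).
- exact: measurableU.
- exact: bfs_setD.
- have h1 := M0_indic_mem mA; have h2 := M0_indic_mem mB.
  have h3 := M0_DE (chi A) (chi B).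
  near=> x; have -> : (chi A + chi B : M0) x = chi A x + chi B x.
    by move: (Logic.I); near: x.
  have -> : chi A x = if x \in A then 1 else 0 by near: x.
  have -> : chi B x = if x \in B then 1 else 0 by near: x.
  move=> [] /mem_set ->; case: ifP => _; rewrite ?(addr0, add0r) ?normr1//.
    by rewrite (normr_nat _ 2) ler1n.
  by rewrite (normr_nat _ 2) ler1n.
- by move=> ? le; split => //; apply: (le_trans le); exact: bfs_normD.
Unshelve. all: by end_near. Qed.

Lemma solid_norm_indicB A B : measurable A -> measurable B -> A `<=` B ->
  bfs_set X (chi B) -> norm (chi B - chi A) <= norm (chi (B `\` A)).
Proof.
move=> mA mB AB XB; have mBA := measurableD mB mA.
apply: (X_solid _ _).2.
  by have [] := solid_indicS mBA mB (@subDsetl _ _ _) XB.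
have h1 := M0_indic_mem mA; have h2 := M0_indic_mem mB.
have h3 := M0_indic_mem mBA; have h4 := M0_DE (chi B) (- chi A).
have h5 := M0_NE (chi A).
near=> x; have -> : (chi B - chi A : M0) x = chi B x + (- chi A : M0) x.
  by move: (Logic.I); near: x.
have -> : (- chi A : M0) x = - chi A x by move: (Logic.I); near: x.
have -> : chi A x = if x \in A then 1 else 0 by near: x.
have -> : chi B x = if x \in B then 1 else 0 by near: x.
have -> : chi (B `\` A) x = if x \in B `\` A then 1 else 0 by near: x.
rewrite in_setD; case: ifPn => Bx; case: ifPn => Ax //=.
- by rewrite subrr.
- by rewrite subr0.
- by move: Ax Bx => /set_mem/AB/mem_set ->.
- by rewrite subr0.
Unshelve. all: by end_near. Qed.

(** * Countable unions of sets with geometrically small norms *)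

Section countable_union.
Variables (E : nat -> set T) (e : R).
Hypothesis mE : forall k, measurable (E k).
Hypothesis XE : forall k, bfs_set X (chi (E k)).
Hypothesis leE : forall k, norm (chi (E k)) <= e / 2 ^+ k.

Let G n m := \bigcup_(k in [set k | n <= k < m]%N) E k.

Let mG n m : measurable (G n m).
Proof. exact: bigcup_measurable. Qed.

Let e_ge0 : 0 <= e.
Proof.
by have := leE 0; rewrite expr0 divr1; apply: le_trans; exact: bfs_norm_ge0.
Qed.

(** The bound is the exact geometric sum of [e / 2 ^+ k] over [n <= k < n + j]. Keeping the
    subtracted term lets the induction close, as [e / 2 ^+ i = 2 * e / 2 ^+ i - 2 * e / 2 ^+
    i.+1]. *)
Lemma solid_indic_finite_union n j : bfs_set X (chi (G n (n + j))) /\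
  norm (chi (G n (n + j))) <= 2 * e / 2 ^+ n - 2 * e / 2 ^+ (n + j).
Proof.
elim: j => [|j [XG leG]].
  have G0 : G n (n + 0) = set0.
    by rewrite -subset0 => x [k /= /andP[]]; rewrite addn0 leqNgt => /negP.
  (* The empty union is dominated by the zero class, whose norm is 0. *)
  have [|||] := @solid_indic 0 (G n (n + 0)).
  - exact: mG.
  - exact: bfs_set0.
  - by rewrite G0; apply: aeW => x [].
  - by rewrite bfs_norm0 addn0 subrr.
have GS : G n (n + j.+1) = G n (n + j) `|` E (n + j)%N.
  apply/seteqP; split => [x [k /= /andP[nk]]|x [[k /= /andP[nk kn] Ex]|Ex]].
  - rewrite addnS ltnS leq_eqVlt => /predU1P[-> ?|kn Ex]; first by right.
    by left; exists k => //=; rewrite nk.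
  - by exists k => //=; rewrite nk addnS ltnS ltnW.
  - by exists (n + j)%N => //=; rewrite leq_addr addnS ltnS/=.
have [XG' leG'] := solid_indicU (mG n (n + j)) (mE (n + j)) XG (XE (n + j)).
rewrite GS; split => //; apply: (le_trans leG').
apply: (le_trans (lerD leG (leE _))).
rewrite -addrA lerD2l addnS exprS invfM.
by rewrite !mulrA [2 * e]mulrC mulfK// mulrDr mulr1 mulrDl opprD addrNK.
Qed.

(* The limit of the indicators of the finite unions equals 1 a.e. on each E k,
   because |chi_(E k) (1 - f)| <= |chi_(G 0 m) - f| for all m > k. *)
Lemma solid_indic_bigcup : bfs_set X (chi (\bigcup_k E k)) /\
  norm (chi (\bigcup_k E k)) <= 2 * e.
Proof.
pose u n := chi (G 0 n).
have Xu n : bfs_set X (u n).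
  by have [] := solid_indic_finite_union 0 n.
have le_u n : norm (u n) <= 2 * e.
  have [_] := solid_indic_finite_union 0 n; rewrite add0n expr0 divr1.
  by move=> /le_trans; apply; rewrite gerBl// divr_ge0// ?mulr_ge0// exprn_ge0.
(* The difference is controlled by [G 0 m] minus [G 0 n], which lies in [G n m]; the norm of the
   latter is a geometric tail. *)
have u_dist n m : (n <= m)%N -> norm (u m - u n) <= 2 * e / 2 ^+ n.
  move=> nm.
  have sub : G 0 n `<=` G 0 m.
    by move=> x [k /= kn Ex]; exists k => //=; exact: leq_trans nm.
  apply: (le_trans (solid_norm_indicB (mG 0 n) (mG 0 m) sub (Xu m))).
  have [XG leG] := solid_indic_finite_union n (m - n).
  rewrite subnKC// in XG leG.
  have [] := solid_indicS (measurableD (mG 0 m) (mG 0 n)) (mG n m) _ XG.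
    move=> x [[k /= km Ex] nG]; exists k => //=; rewrite km andbT leqNgt.
    by apply/negP => kn; apply: nG; exists k.
  move=> _ /le_trans; apply; apply: (le_trans leG).
  by rewrite gerBl// divr_ge0// ?mulr_ge0// exprn_ge0.
have [f Xf uf] : exists2 f, bfs_set X f &
    (norm (u n - f) @[n --> \oo] --> (0 : R)).
  apply: bfs_complete => // r r0.
  have /cvgrPdist_lt/(_ _ r0)[N _ HN] :
      (2 * e * (2^-1) ^+ n) @[n --> \oo] --> (0 : R).
    rewrite -[X in _ --> X](mulr0 (2 * e)); apply: cvgMl_tmp.
    exact: cvg_half_expr.
  have small n m : (N <= n)%N -> (n <= m)%N -> norm (u m - u n) < r.
    move=> Nn nm; apply: le_lt_trans (u_dist _ _ nm) _.
    have := HN _ Nn; rewrite sub0r normrN; apply: le_lt_trans.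
    by rewrite exprVn; exact: ler_norm.
  exists N => m n Nm Nn; have [nm|/ltnW mn] := leqP n m; first exact: small.
  by rewrite -opprB bfs_normN ?small//; exact: bfs_setB.
have f1 k : {ae mu, forall x, E k x -> f x = 1}.
  pose h x : R[i] := if x \in E k then 1 - f x else 0.
  have mh : measurable_fun setT h.
    apply: measurable_fun_complex_restr => //.
    apply: measurable_fun_complexD => //.
    under eq_fun do rewrite -mulN1r.
    exact/measurable_fun_complexZ/measurable_M0.
  have hE := M0_classE mu mh.
  have hle m : (k < m)%N ->
      bfs_set X (M0_class mu h) /\ norm (M0_class mu h) <= norm (u m - f).
    move=> km; apply: X_solid; first exact: bfs_setB.
    have h1 := M0_indic_mem (mG 0 m); have h4 := M0_DE (u m) (- f).
    have h5 := M0_NE f.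
    near=> x; have -> : M0_class mu h x = h x by move: (Logic.I); near: x.
    have -> : (u m - f : M0) x = u m x + (- f : M0) x.
      by move: (Logic.I); near: x.
    have -> : (- f : M0) x = - f x by move: (Logic.I); near: x.
    have -> : u m x = if x \in G 0 m then 1 else 0 by near: x.
    rewrite /h; case: ifPn => [/set_mem Ex|]; last by rewrite normr0.
    by rewrite mem_set//; exists k.
  have [Xh _] := hle _ (leqnn k.+1).
  (* The class of [h] does not depend on [m], while the bounds [norm (u m - f)] tend to 0. *)
  have h0 : norm (M0_class mu h) = 0.
    apply/eqP; rewrite eq_le bfs_norm_ge0// andbT.
    apply: (ler_cvg_to (cvg_cst _) uf).
    by near=> m; apply: (hle m _).2; near: m; exact: nbhs_infty_gt.
  have h2 := M0_0E mu.
  have {}h0 := bfs_norm_eq0 Xh h0; rewrite h0 in hE.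
  near=> x; move=> /mem_set Ex.
  have : h x = 0.
    transitivity ((0 : M0) x); last by move: (Logic.I); near: x.
    by apply/esym; move: (Logic.I); near: x.
  by rewrite /h Ex => /eqP; rewrite subr_eq0 => /eqP.
have mU : measurable (\bigcup_k E k) by exact: bigcup_measurable.
have [|XU leU] := @solid_indic f (\bigcup_k E k) mU Xf.
  apply: filterS (ae_foralln f1) => x fx [k _ Ex].
  by rewrite (fx k)// normr1.
split => //; apply: (le_trans leU).
(* The triangle inequality bounds [norm f] by [norm (u n) + norm (u n - f)], hence by [2 * e] in the
   limit. *)
have lim2e : 2 * e + norm (u n - f) @[n --> \oo] --> 2 * e + (0 : R).
  by apply: cvgD => //; exact: cvg_cst.
rewrite -[leRHS]addr0; apply: (ler_cvg_to (cvg_cst _) lim2e).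
near=> n; rewrite -(@bfs_normN (u n - f)); last exact: bfs_setB.
rewrite opprB -[f in leLHS](addrNK (u n)) addrC.
apply: le_trans (bfs_normD _ _) _ => //; first exact: bfs_setB.
by rewrite lerD2r.
Unshelve. all: by end_near. Qed.

End countable_union.

Lemma indic_norm_le0 E : measurable E ->
  bfs_set X (chi E) -> (forall n, norm (chi E) <= 1 / 2 ^+ n) -> mu E = 0%E.
Proof.
move=> mE XE le2; apply/eqP; rewrite -measure_le0 leNgt; apply/negP => muE.
have := bfs_norm_indic_gt0 (And3 mE muE XE); rewrite ltNge => /negP; apply.
apply: (ler_cvg_to (cvg_cst _) (@cvg_half_expr R)).
by apply: nearW => n; rewrite exprVn -div1r.
Qed.

End banach_function_space_theory.

(** For [i < j], the later difference lies in [F (m j)], hence in [F (m i).+1], which the earlier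
    difference removes. *)
Lemma decreasing_setD_disjoint (T : Type) (F : nat -> set T) (m : nat -> nat) :
  (forall i j, (i <= j)%N -> F j `<=` F i) ->
  (forall k, (m k < m k.+1)%N) ->
  forall i j, i <> j ->
  (F (m i) `\` F (m i).+1) `&` (F (m j) `\` F (m j).+1) = set0.
Proof.
move=> decF mS i j ij; wlog lt_ij : i j ij / (i < j)%N.
  by case: (ltngtP i j) ij => // [lt ? /(_ i j)|gt ? /(_ j i)];
    [apply|rewrite setIC; apply=> //; apply/eqP; rewrite ltn_eqF].
rewrite -subset0 => x [[_ nF] [Fx _]]; apply: nF; apply: decF Fx.
have m_mono : {homo m : i j / (i < j)%N}.
  by apply: homo_ltn => // ? ? ?; exact: ltn_trans.
exact: m_mono.
Qed.

(** * Extraction of disjoint sets with small norms *)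

Theorem lemma3p3 (R : realType) (d : measure_display) (T : measurableType d)
    (mu : {measure set T -> \bar R}) (X : banach_function_space mu)
    (mu_sigma_finite : sigma_finite setT mu) (X_solid : solid X) :
  ereal_inf [set (bfs_norm X (M0_indic mu E))%:E | E in bfs_indic_sets X] = 0%E
  <->
  exists A : nat -> set T,
    [/\ forall n, bfs_indic_sets X (A n),
        forall m n, m <> n -> A n `&` A m = set0 &
        forall n, 0 < bfs_norm X (M0_indic mu (A n)) <= 1 / 2 ^+ n.+1].
Proof.
split=> [inf0|[A [A0 _ leA]]]; last first.
  apply/eqP; rewrite eq_le; apply/andP; split; last first.
    apply: le_ereal_inf_tmp => _ [E [mE muE XE] <-].
    by rewrite lee_fin bfs_norm_ge0.
  apply/lee_addgt0Pr => r r0; rewrite add0e.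
  (* The limit is read off at [N.+1], the exponent in the bound on [A N], since the sequence starts
     at index 0. *)
  have /cvgrPdist_lt/(_ _ r0)[N _ /(_ _ (leqnSn N))] := @cvg_half_expr R.
  rewrite sub0r normrN exprVn => ltr.
  apply: (@le_trans _ _ (bfs_norm X (M0_indic mu (A N)))%:E).
    by apply: ereal_inf_lbound; exists (A N).
  rewrite lee_fin; have /andP[_ /le_trans] := leA N; apply.
  by rewrite div1r (le_trans (ler_norm _))// ltW.
(* The factor 1/4 absorbs the 2 in [solid_indic_bigcup]: the tail union [F n] then has norm at most
   [2 * (1 / 4 / 2 ^+ n) = 1 / 2 ^+ n.+1]. *)
have exE n : exists E, bfs_indic_sets X E /\
    bfs_norm X (M0_indic mu E) <= 1 / 4 / 2 ^+ n.
  have : (ereal_inf [set (bfs_norm X (M0_indic mu E))%:E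
      | E in bfs_indic_sets X] < (1 / 4 / 2 ^+ n)%:E)%E.
    by rewrite inf0 lte_fin divr_gt0// exprn_gt0.
  move=> /ereal_inf_lt[_ [E E0 <-]]; rewrite lte_fin => /ltW ltE.
  by exists E.
have [E /all_and2[E0 leE]] := choice exE.
have mE k : measurable (E k) by have [] := E0 k.
pose F n := \bigcup_k E (n + k)%N.
have mF n : measurable (F n) by exact: bigcup_measurable.
have [XF leF] : (forall n, bfs_set X (M0_indic mu (F n))) /\
    forall n, bfs_norm X (M0_indic mu (F n)) <= 1 / 2 ^+ n.+1.
  apply: all_and2 => n.
  have [|k|k|] := @solid_indic_bigcup _ _ _ mu X X_solid
    (fun k => E (n + k)%N) (1 / 4 / 2 ^+ n) _.
  - by move=> k.
  - by have [] := E0 (n + k)%N.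
  - by rewrite (le_trans (leE _))// exprD invfM mulrA.
  move=> XF leF; split => //; apply: (le_trans leF).
  rewrite exprS invfM !mulrA; apply: ler_wpM2r; last by lra.
  by rewrite invr_ge0 exprn_ge0.
have decF i j : (i <= j)%N -> F j `<=` F i.
  move=> ij x [k _ Ex]; exists (j - i + k)%N => //.
  by rewrite addnA subnKC.
have muF n : (0 < mu (F n))%E.
  have [_ muE _] := E0 n; apply: (lt_le_trans muE).
  apply: le_measure; rewrite ?inE//.
  by move=> x Ex; exists 0%N => //; rewrite addn0.
have mI : measurable (\bigcap_n F n) by exact: bigcap_measurable.
have muI : mu (\bigcap_n F n) = 0%E.
  have subI n : \bigcap_n F n `<=` F n by exact: bigcap_inf.
  have leI n := solid_indicS X_solid mI (mF n) (subI n) (XF n).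
  apply: indic_norm_le0 => //; first exact: (leI 0%N).1.
  move=> n; apply: (le_trans (leI n).2); apply: (le_trans (leF n)).
  rewrite ler_pM2l// lef_pV2 ?posrE ?exprn_gt0// exprS.
  by rewrite ler_peMl ?exprn_ge0// ler1n.
(* Otherwise all differences from [n] on are null. A point of [F n] outside all of them stays in
   every later set, hence in the intersection, so [F n] would be null. *)
have exm n : exists m, (n <= m)%N /\ (0 < mu (F m `\` F m.+1))%E.
  apply: contrapT => nex.
  have null m : mu.-negligible (F (n + m)%N `\` F (n + m).+1).
    apply/negligibleP; first exact: measurableD.
    apply/eqP; rewrite -measure_le0 leNgt; apply/negP => gt0.
    by apply: nex; exists (n + m)%N; rewrite leq_addr.
  have nullI : mu.-negligible (\bigcap_n F n) by apply/negligibleP.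
  have : mu.-negligible (F n).
    apply: negligibleS (negligibleU nullI (negligible_bigcup null)) => x Fx.
    have [?|nI] := pselect ((\bigcap_n F n) x); [by left|right].
    apply: contrapT => nU; apply: nI.
    have Fnm m : F (n + m)%N x.
      elim: m => [|m Fm]; first by rewrite addn0.
      rewrite addnS; apply: contrapT => nF; apply: nU; by exists m.
    by move=> m _; apply: decF (Fnm m); rewrite leq_addl.
  by move=> /(measure_negligible (mF n)) F0; have := muF n; rewrite F0 ltxx.
have [g /all_and2[leg mug]] := choice exm.
(* Searching from [(m k').+1] makes [m] strictly increasing, which gives disjointness. It also
   yields [k <= m k], so the bound for [F (m k)] is at most [1 / 2 ^+ k.+1]. *)
pose m := fix m k := if k is k'.+1 then g (m k').+1 else g 0%N.
have mS k : (m k < m k.+1)%N by exact: leg.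
have le_m k : (k <= m k)%N.
  by elim: k => // k IH; apply: leq_ltn_trans IH (mS k).
have mugm k : (0 < mu (F (m k) `\` F (m k).+1))%E.
  by case: k => [|k]; exact: mug.
have mD k : measurable (F (m k) `\` F (m k).+1) by exact: measurableD.
have XD k := solid_indicS X_solid (mD k) (mF _) (@subDsetl _ _ _) (XF (m k)).
have D0 k : bfs_indic_sets X (F (m k) `\` F (m k).+1).
  by split => //; exact: (XD k).1.
exists (fun k => F (m k) `\` F (m k).+1); split => //.
  by move=> i j /nesym; exact: decreasing_setD_disjoint.
move=> k; rewrite bfs_norm_indic_gt0//=.
apply: (le_trans (XD k).2); apply: (le_trans (leF _)).
rewrite ler_pM2l// lef_pV2 ?posrE ?exprn_gt0// ler_eXn2l ?ltr1n//.
by rewrite ltnS.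
Qed.
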